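(* Let $f:\mathbb{R}\to\mathbb{R}$ and consider the iteration $x_{k+1}=f(x_k)$ with a fixed point $x^*$ such that for some $c\in[0,1)$ we have $$|f(x)-x^*|\le c\,|x-x^*|$$ for all $x$. Consider a sequence of perturbations $(e_k)_{k\ge0}$ of real numbers such that for some $a\in[0,1)$ we have $|e_{k+1}|<a|e_k|$ for all $k$. Then the perturbed sequence $w_{k+1}=f(w_k)+e_k$ converges to $x^*$ for any $w_0\in\mathbb{R}$.
   Context: No conventions beyond standard real analysis are needed. *)

(* Defs.v *)
From Stdlib Require Export Reals.

(* Main.v *)
Require Import Defs.
From Stdlib Require Import Reals.
From Stdlib Require Import Lra.
Open Scope R_scope.

(** The error [d k = |w k - xstar|] and the perturbation [b k = |e k|] obey the
    triangular linear recursion [d (k+1) <= c * d k + b k],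
    [b (k+1) <= a * b k], whose matrix has the eigenvalues [c] and [a].  Hence,
    for any rate [r] with [c <= r] and [a < r < 1], a suitably weighted norm
    [d + M * b] shrinks by the factor [r] at every step.  This Lyapunov
    function gives [d k <= V * r ^ k] for a constant [V], which forces
    convergence.  The strict gap [a < r] pays for the coupling term [b k]; it
    also covers the resonant case [a = c], where the decay is only of order
    [k * a ^ k]. *)

Lemma Un_cv_of_geometric_bound (u : nat -> R) (l V r : R) :
  0 <= V -> 0 <= r < 1 ->
  (forall k, Rabs (u k - l) <= V * r ^ k) -> Un_cv u l.
Proof.
  intros HV Hr Hu eps Heps.
  assert (Habs : Rabs r < 1) by (rewrite Rabs_pos_eq; lra).
  (* The denominator [V + 1] avoids a separate case for [V = 0]. *)
  destruct (pow_lt_1_zero r Habs (eps / (V + 1))) as [N HN].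
  { apply Rdiv_lt_0_compat; lra. }
  exists N; intros n Hn.
  specialize (HN n Hn).
  assert (Hpow : 0 <= r ^ n) by (apply pow_le; lra).
  rewrite Rabs_pos_eq in HN by exact Hpow.
  apply (Rmult_lt_compat_l (V + 1)) in HN; [| lra].
  replace ((V + 1) * (eps / (V + 1))) with eps in HN by (field; lra).
  unfold Rdist.
  specialize (Hu n).
  lra.
Qed.

(** The weight [M = / (r - a)] is the solution of [1 + M * a = r * M]: with it,
    the inflow [b k] into [d (k+1)] is exactly absorbed by the surplus decay of
    [b], so that [d + M * b] contracts by [r]. *)
Lemma perturbed_contraction_geometric_bound (d b : nat -> R) (c a r : R) :
  c <= r -> a < r -> 0 <= r ->
  (forall k, 0 <= d k) -> (forall k, 0 <= b k) ->
  (forall k, d (S k) <= c * d k + b k) ->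
  (forall k, b (S k) <= a * b k) ->
  forall k, d k <= (d 0%nat + / (r - a) * b 0%nat) * r ^ k.
Proof.
  intros Hcr Har Hr Hd Hb Hds Hbs.
  set (M := / (r - a)).
  assert (HM : 0 < M) by (apply Rinv_0_lt_compat; lra).
  assert (HMeq : 1 + M * a = r * M) by (unfold M; field; lra).
  assert (Hstep : forall k, d (S k) + M * b (S k) <= r * (d k + M * b k)).
  { intros k.
    assert (Hb' : M * b (S k) <= M * (a * b k))
      by (apply Rmult_le_compat_l; [lra | apply Hbs]).
    assert (Hd' : c * d k <= r * d k)
      by (apply Rmult_le_compat_r; [apply Hd | exact Hcr]).
    replace (r * (d k + M * b k)) with (r * d k + (r * M) * b k) by ring.
    rewrite <- HMeq.
    specialize (Hds k).
    lra. }
  assert (HV : forall k,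
            d k + M * b k <= (d 0%nat + M * b 0%nat) * r ^ k).
  { induction k as [| k IH].
    - simpl; lra.
    - apply Rle_trans with (1 := Hstep k).
      apply (Rmult_le_compat_l r) in IH; [| exact Hr].
      simpl; lra. }
  intros k.
  assert (0 <= M * b k) by (apply Rmult_le_pos; [lra | apply Hb]).
  specialize (HV k).
  lra.
Qed.

Theorem lemma3p3 (f : R -> R) (xstar c a : R) (e : nat -> R)
    (Hfix : f xstar = xstar)
    (Hc : 0 <= c < 1)
    (Hf : forall x : R, Rabs (f x - xstar) <= c * Rabs (x - xstar))
    (Ha : 0 <= a < 1)
    (He : forall k : nat, Rabs (e (S k)) < a * Rabs (e k)) :
  forall w : nat -> R,
    (forall k : nat, w (S k) = f (w k) + e k) -> Un_cv w xstar.
Proof.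
  intros w Hw.
  set (r := (1 + Rmax a c) / 2).
  assert (Hr : c <= r /\ a < r /\ 0 <= r < 1)
    by (unfold r, Rmax; destruct (Rle_dec a c); lra).
  destruct Hr as (Hcr & Har & Hr).
  apply (Un_cv_of_geometric_bound w xstar
           (Rabs (w 0%nat - xstar) + / (r - a) * Rabs (e 0%nat)) r).
  - apply Rplus_le_le_0_compat; [apply Rabs_pos |].
    apply Rmult_le_pos; [| apply Rabs_pos].
    apply Rlt_le, Rinv_0_lt_compat; lra.
  - exact Hr.
  - apply (perturbed_contraction_geometric_bound
             (fun k => Rabs (w k - xstar)) (fun k => Rabs (e k)) c a r);
      try lra; intros k; try apply Rabs_pos.
    + rewrite Hw.
      replace (f (w k) + e k - xstar) with ((f (w k) - xstar) + e k) by ring.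
      apply Rle_trans with (1 := Rabs_triang _ _).
      specialize (Hf (w k)).
      lra.
    + apply Rlt_le, He.
Qed.
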